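(* For every integer $n\geq 8$, the set $\mathcal{F}_{\mathrm{fin}}(n)$ is not closed in $\mathbb{M}_n(\mathbb{C})$.
   Context: For a positive integer $n$, $\mathcal{F}_{\mathrm{fin}}(n)$ denotes the set of all $n\times n$ complex matrices $(a_{ij})_{1\leq i,j\leq n}$ for which there exist a finite-dimensional von Neumann algebra $\mathcal{M}$ with a faithful tracial state $\tau$ and unitaries $U_1,\dots,U_n\in\mathcal{M}$ such that $a_{ij}=\tau(U_j^*U_i)$ for all $1\leq i,j\leq n$. *)

(* Defs.v *)
From HB Require Import structures.
From mathcomp Require Import all_boot all_order all_algebra.
From mathcomp Require Import all_classical all_reals all_analysis.
From mathcomp Require Import complex Rstruct Rstruct_topology.
Import GRing.Theory Num.Theory numFieldTopology.Exports numFieldNormedType.Exports.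
Set Implicit Arguments. Unset Strict Implicit. Unset Printing Implicit Defensive.
Local Open Scope ring_scope.

Definition C : Type := (Rdefinitions.R)[i].
HB.instance Definition _ := Num.ClosedField.on C.
(* Metric topology on C induced by the modulus |z|; matrices 'M[C]_(m,n)
   then carry the (entrywise) product topology. *)
HB.instance Definition _ := PseudoPointedMetric.copy C C^o.

Definition adjmx (N : nat) (x : 'M[C]_N) : 'M[C]_N := (map_mx Num.conj x)^T.

(* A finite-dimensional von Neumann algebra, concretely: a unital
   *-subalgebra A of M_N(C) for some N (every finite-dimensional von Neumann
   algebra is of this form; such subalgebras are automatically weakly closed). *)
Definition fd_vN_algebra (N : nat) (A : 'M[C]_N -> Prop) : Prop :=
  [/\ A 1%:M,
      (forall x y, A x -> A y -> A (x + y)),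
      (forall (c : C) x, A x -> A (c *: x)),
      (forall x y, A x -> A y -> A (x *m y)) &
      (forall x, A x -> A (adjmx x))].

(* A faithful tracial state tau on A (only its values on A matter). *)
Definition faithful_tracial_state (N : nat) (A : 'M[C]_N -> Prop)
    (tau : 'M[C]_N -> C) : Prop :=
  (forall x y, A x -> A y -> tau (x + y) = tau x + tau y) /\
  (forall (c : C) x, A x -> tau (c *: x) = c * tau x) /\
  tau 1%:M = 1 /\
  (forall x, A x -> 0 <= tau (adjmx x *m x)) /\
  (forall x, A x -> tau (adjmx x *m x) = 0 -> x = 0) /\
  (forall x y, A x -> A y -> tau (x *m y) = tau (y *m x)).

Definition unitary_in (N : nat) (A : 'M[C]_N -> Prop) (U : 'M[C]_N) : Prop :=
  [/\ A U, adjmx U *m U = 1%:M & U *m adjmx U = 1%:M].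

Definition F_fin (n : nat) : set 'M[C]_n :=
  fun a => exists (N : nat) (A : 'M[C]_N -> Prop) (tau : 'M[C]_N -> C)
                  (U : 'I_n -> 'M[C]_N),
    [/\ fd_vN_algebra A, faithful_tracial_state A tau,
        (forall i, unitary_in A (U i)) &
        (forall i j, a i j = tau (adjmx (U j) *m U i))].
Arguments F_fin n : clear implicits.

(* Main.v *)
(* Take unitaries A_0, ..., A_3 placed on a 4-cycle and, for each edge, the
   "midpoint" B_k = (A_k + i w_k A_(k+1)) / sqrt 2, where w_k = 1 except for
   w_2 = lam.  Given that the A_k are unitary, B_k is unitary iff
   A_k^* (w_k A_(k+1)) is selfadjoint.  The relations defining the B_k can be
   read off the Gram matrix because the trace is faithful.  In M_N(C) the four
   selfadjointness conditions force det(A_k)^2 = det(w_k A_(k+1))^2, and going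
   once around the cycle gives lam^(2N) = 1.  So the Gram matrix of the eight
   unitaries, with the A_k orthonormal, is not in F_fin when lam is not a root
   of unity.  When lam is a root of unity it is realised by monomial matrices.
   The Gram matrix is Lipschitz in lam, and the roots of unity accumulate at
   (3 + 4i) / 5, which is not one of them. *)

Require Import Defs.
From HB Require Import structures.
From mathcomp Require Import all_boot all_order all_algebra.
From mathcomp Require Import complex Rstruct.
From mathcomp Require Import all_classical all_reals all_analysis.
From mathcomp Require Import zify ring lra.
Import numFieldTopology.Exports numFieldNormedType.Exports.
Import Order.TTheory GRing.Theory Num.Theory.
Set Implicit Arguments. Unset Strict Implicit. Unset Printing Implicit Defensive.
Local Open Scope classical_set_scope.
Local Open Scope ring_scope.

(** * Gram matrix of the four-cycle *)

Definition edge_phase (lam : C) (k : nat) : C := if k == 2 then lam else 1.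

(* The coordinates of U_i in the A_k: U_i = A_i for i < 4, U_(4+i) = B_i for
   i < 4, and U_i = A_0 for the padding indices i >= 8. *)
Definition coef (lam : C) (i : nat) (k : 'I_4) : C :=
  if (i < 4)%N then (i == k :> nat)%:R
  else if (i < 8)%N then
    ((i - 4 == k :> nat)%N%:R
     + 'i * edge_phase lam (i - 4) * ((i - 4).+1 %% 4 == k :> nat)%N%:R)
    / sqrtC 2
  else (0 == k :> nat)%N%:R.

Definition gram (n : nat) (lam : C) : 'M[C]_n :=
  \matrix_(i, j) \sum_k coef lam i k * (coef lam j k)^*.

(** * Adjoints and midpoints of unitaries *)

Lemma adjmxD N (x y : 'M[C]_N) : adjmx (x + y) = adjmx x + adjmx y.
Proof. by rewrite /adjmx map_mxD linearD. Qed.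

Lemma adjmxZ N (c : C) (x : 'M[C]_N) : adjmx (c *: x) = c^* *: adjmx x.
Proof. by rewrite /adjmx map_mxZ linearZ. Qed.

Lemma adjmx_sum N I (r : seq I) (P : pred I) (F : I -> 'M[C]_N) :
  adjmx (\sum_(i <- r | P i) F i) = \sum_(i <- r | P i) adjmx (F i).
Proof. by rewrite /adjmx rmorph_sum /= linear_sum. Qed.

Lemma det_adjmx N (x : 'M[C]_N) : \det (adjmx x) = (\det x)^*.
Proof. by rewrite /adjmx det_tr det_map_mx. Qed.

Lemma sqrtC2_neq0 : sqrtC 2 != 0 :> C.
Proof. by rewrite sqrtC_eq0 pnatr_eq0. Qed.

Lemma normC_sqrtC2V (F : numClosedFieldType) :
  ((sqrtC 2)^-1)^* * (sqrtC 2)^-1 = 2^-1 :> F.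
Proof.
rewrite fmorphV /= (CrealP _); last by rewrite ger0_real // sqrtC_ge0 ler0n.
by rewrite -invfM -expr2 sqrtCK.
Qed.

(** One matrix entry of [adjmx_mid]: [e] is an entry of the identity, [a] and [b] are entries of x^*
    y and y^* x. *)
Lemma midpoint_expand (F : numClosedFieldType) (a b e : F) :
  2^-1 * (e + 'i * a + (- 'i * b + - 'i * ('i * e))) = e + 'i / 2 * (a - b).
Proof.
rewrite [- 'i * ('i * e)]mulrA [- 'i * 'i]mulNr -expr2 sqrCi opprK mul1r; move: 'i => z.
have h2 : 2^-1 + 2^-1 = 1 :> F by rewrite -mulr2n -[LHS]mulr_natr mulVf ?pnatr_eq0.
by rewrite -[in RHS](mul1r e) -[X in X * e + _]h2; move: _^-1 => h; ring.
Qed.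

Lemma adjmx_mid N (x y : 'M[C]_N) :
    adjmx x *m x = 1%:M -> adjmx y *m y = 1%:M ->
  adjmx ((sqrtC 2)^-1 *: (x + 'i *: y)) *m ((sqrtC 2)^-1 *: (x + 'i *: y)) =
  1%:M + ('i / 2) *: (adjmx x *m y - adjmx y *m x).
Proof.
move=> hx hy; rewrite adjmxZ adjmxD adjmxZ -scalemxAl -scalemxAr scalerA.
rewrite normC_sqrtC2V mulmxDl !mulmxDr -!scalemxAl -!scalemxAr hx hy conjCi.
move: (adjmx x *m y) (adjmx y *m x) => u v; apply/matrixP => i j; rewrite !mxE.
exact: midpoint_expand.
Qed.

(** By [adjmx_mid], m^* m - 1 is x^* y - y^* x times the nonzero scalar i/2. *)
Lemma mid_unitaryP N (x y : 'M[C]_N) (m := (sqrtC 2)^-1 *: (x + 'i *: y)) :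
    adjmx x *m x = 1%:M -> adjmx y *m y = 1%:M ->
  (adjmx m *m m = 1%:M) <-> (adjmx x *m y = adjmx y *m x).
Proof.
move=> hx hy; rewrite /m adjmx_mid //; split=> [|->]; last first.
  by rewrite subrr scaler0 addr0.
move/(congr1 (fun z => z - 1%:M)); rewrite addrAC subrr add0r.
move/eqP; rewrite scaler_eq0 mulf_eq0 invr_eq0 pnatr_eq0 orbF /=.
rewrite (negbTE (@neq0Ci C)) /= subr_eq0 => /eqP; exact.
Qed.

Lemma det_unitary_neq0 N (x : 'M[C]_N) : adjmx x *m x = 1%:M -> \det x != 0.
Proof.
move=> /(congr1 determinant); rewrite det_mulmx det1 => h.
by apply: contra_eq_neq h => ->; rewrite mulr0 eq_sym oner_eq0.
Qed.

(** Determinants turn the hypothesis into conj(a) b = conj(b) a with |a| = |b| = 1; multiplying by a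
    b gives the claim. *)
Lemma det_sqr_selfadjoint N (x y : 'M[C]_N) :
    adjmx x *m x = 1%:M -> adjmx y *m y = 1%:M ->
  adjmx x *m y = adjmx y *m x -> \det x ^+ 2 = \det y ^+ 2.
Proof.
move=> hx hy /(congr1 determinant).
have := congr1 determinant hx; have := congr1 determinant hy.
rewrite !det_mulmx !det_adjmx det1; move: (\det x) (\det y) => a b hb ha hab.
by rewrite -[LHS]mul1r -hb -mulrA [b * _]mulrC mulrA expr2 !mulrA -hab
  [a^* * b * a]mulrAC ha mul1r expr2.
Qed.

Lemma coef_vertex lam (k l : 'I_4) : coef lam k l = (k == l)%:R.
Proof. by rewrite /coef ltn_ord. Qed.

Lemma coef_edge lam (k l : 'I_4) : coef lam (4 + k) l =
  (sqrtC 2)^-1 * ((k == l)%:R + 'i * (edge_phase lam k * (ordS k == l)%:R)).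
Proof.
rewrite /coef ltnNge leq_addr (ltn_add2l 4 k 4) ltn_ord addKn.
by rewrite mulrC mulrA.
Qed.

(** * The determinant obstruction in finite dimension *)

Section FiniteDimensionalObstruction.
Variables (N : nat) (A : 'M[C]_N -> Prop) (tau : 'M[C]_N -> C).
Hypotheses (algA : fd_vN_algebra A) (stateA : faithful_tracial_state A tau).

Lemma algebra_sum I (r : seq I) (F : I -> 'M[C]_N) :
  (forall i, A (F i)) -> A (\sum_(i <- r) F i).
Proof.
case: algA => A1 AD AZ _ _ AF; elim/big_ind: _ => [|x y Ax Ay|i _].
- by rewrite -(scale0r 1%:M); apply: AZ.
- exact: AD.
- exact: AF.
Qed.

Lemma state_sum I (r : seq I) (F : I -> 'M[C]_N) :
  (forall i, A (F i)) -> tau (\sum_(i <- r) F i) = \sum_(i <- r) tau (F i).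
Proof.
case: algA => A1 _ _ _ _; case: stateA => tD [tZ _] AF.
elim: r => [|i r IH]; last first.
  by rewrite !big_cons tD // ?IH //; apply: algebra_sum.
by rewrite !big_nil -(scale0r 1%:M) tZ // mul0r.
Qed.

Lemma state_dim_gt0 : (0 < N)%N.
Proof.
case: algA => A1 _ _ _ _; case: stateA => _ [tZ [t1 _]].
case: posnP => // N0; move/eqP: t1; have -> : 1%:M = 0 *: 1%:M :> 'M[C]_N.
  by apply/matrixP => i; have := leq_trans (ltn_ord i) (eq_leq N0).
by rewrite tZ // mul0r eq_sym oner_eq0.
Qed.

(** The double sum is tau(D^* D) for D the combination of the [U i] with coefficients [d i], so
    faithfulness gives D = 0. *)
Lemma gram_relation (I : finType) (U : I -> 'M[C]_N) (d : I -> C) :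
    (forall i, A (U i)) ->
  \sum_i \sum_j d i * (d j)^* * tau (adjmx (U j) *m U i) = 0 ->
  \sum_i d i *: U i = 0.
Proof.
case: algA => A1 AD AZ AM AS; case: stateA => tD [tZ [_ [_ [tF _]]]] AU h.
apply: tF; first by apply: algebra_sum => i; apply: AZ.
rewrite adjmx_sum mulmx_sumr state_sum; last first.
  move=> i; apply: AM; last exact: AZ.
  by apply: algebra_sum => j; apply/AS/AZ.
rewrite -[RHS]h; apply: eq_bigr => i _; rewrite mulmx_suml state_sum; last first.
  by move=> j; apply: AM; [apply/AS/AZ|apply: AZ].
apply: eq_bigr => j _; rewrite adjmxZ -scalemxAl -scalemxAr scalerA mulrC.
by rewrite tZ ?[_^* * _]mulrC //; apply: AM => //; apply: AS.
Qed.

End FiniteDimensionalObstruction.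

Lemma gram_F_fin_root_of_unity n lam :
    (8 <= n)%N -> `|lam| = 1 -> F_fin n (gram n lam) ->
  exists2 N, (0 < N)%N & lam ^+ N = 1.
Proof.
move=> n8 lam1 [N [A [tau [U0 [algA stA uU hU]]]]].
pose U (i : 'I_8) := U0 (widen_ord n8 i).
pose V (k : 'I_4) := U (lshift 4 k : 'I_8).
have UA i : A (U i) by case: (uU (widen_ord n8 i)).
have U1 i : adjmx (U i) *m U i = 1%:M by case: (uU (widen_ord n8 i)).
have gU i j : tau (adjmx (U j) *m U i) = \sum_k coef lam i k * (coef lam j k)^*.
  by rewrite -hU mxE.
have key k : U (rshift 4 k : 'I_8) =
    (sqrtC 2)^-1 *: (V k + 'i *: (edge_phase lam k *: V (ordS k))).
  pose c := (sqrtC 2)^-1 : C; pose w := edge_phase lam k.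
  (* The coefficients of the expected relation B_k - c A_k - c i w A_(k+1) = 0. *)
  pose d (i : 'I_8) : C := (i == rshift 4 k)%:R - c * (i == lshift 4 k)%:R
     - c * 'i * w * (i == lshift 4 (ordS k))%:R.
  (* Stated over any module because it serves both for coordinates in [C^o] and for matrices. *)
  have dsum (W : lmodType C) (F : 'I_8 -> W) : \sum_i d i *: F i =
      F (rshift 4 k) - c *: F (lshift 4 k) - (c * 'i * w) *: F (lshift 4 (ordS k)).
    have del (e : C) j : \sum_i (e * (i == j)%:R) *: F i = e *: F j.
      rewrite (bigD1 j) //= eqxx mulr1 big1 ?addr0 // => i /negbTE->.
      by rewrite mulr0 scale0r.
    rewrite -[F (rshift 4 k)]scale1r -!del -!sumrB; apply: eq_bigr => i _.
    by rewrite !scalerBl mul1r.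
  have dcoef l : \sum_i d i *: (coef lam i l : C^o) = 0.
    rewrite dsum (coef_edge lam k) !coef_vertex.
    by rewrite /GRing.scale /= -/c -/w; ring.
  have := gram_relation algA stA (U := U) (d := d) UA.
  rewrite dsum => /(_ _)/eqP; rewrite !subr_eq0 => h.
  rewrite scalerDr !scalerA addrC; apply/eqP; rewrite -subr_eq; apply: h.
  (* The Gram matrix factors through [coef], so its quadratic form at [d] is a sum of four squared
     moduli, each zero by [dcoef]. *)
  have -> : \sum_i \sum_j d i * (d j)^* * tau (adjmx (U j) *m U i) =
      \sum_l (\sum_i d i * coef lam i l) * (\sum_j d j * coef lam j l)^*.
    under [RHS]eq_bigr do rewrite rmorph_sum big_distrlr /=.
    rewrite [RHS]exchange_big; apply: eq_bigr => i _; rewrite [RHS]exchange_big.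
    apply: eq_bigr => j _; rewrite gU mulr_sumr; apply: eq_bigr => l _.
    by rewrite rmorphM /= mulrACA.
  by apply: big1 => l _; rewrite [X in X * _]dcoef mul0r.
have edge (k : 'I_4) : \det (V k) ^+ 2 = \det (edge_phase lam k *: V (ordS k)) ^+ 2.
  have w1 : adjmx (edge_phase lam k *: V (ordS k)) *m
      (edge_phase lam k *: V (ordS k)) = 1%:M.
    rewrite adjmxZ -scalemxAl -scalemxAr U1 scalerA mulrC -normCK.
    by rewrite /edge_phase; case: ifP; rewrite ?lam1 ?normr1 expr1n scale1r.
  apply: det_sqr_selfadjoint => //; first exact: U1.
  by apply/mid_unitaryP => //; [exact: U1|rewrite -key; exact: U1].
have D0 : \det (V 0) ^+ 2 != 0 by rewrite expf_neq0 // det_unitary_neq0 // U1.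
(* The scalar [lam] contributes lam^N to the determinant, and the edge relations square it. *)
exists (N * 2)%N; first by rewrite muln_gt0 (state_dim_gt0 algA stA).
have e (k : 'I_4) : (k != 2 :> nat) -> \det (V k) ^+ 2 = \det (V (ordS k)) ^+ 2.
  by move=> k2; rewrite edge /edge_phase (negbTE k2) scale1r.
apply: (mulIf D0); rewrite mul1r.
(* Going around the cycle returns to vertex 0, and only the edge leaving vertex 2 picks up a
   factor. *)
pose s := @ordS 4; have s4 : s (s (s (s 0))) = 0 by apply: val_inj.
have e2 := edge (s (s 0)); have -> : lam ^+ (N * 2) * \det (V 0) ^+ 2 =
  \det (lam *: V (s (s (s 0)))) ^+ 2.
  by rewrite detZ exprMn -exprM (e (s (s (s 0)))) // -/s s4.
by rewrite -[lam in LHS]/(edge_phase lam (s (s 0))) -e2 -(e (s 0)) // -(e 0).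
Qed.

(** * Realisation at roots of unity *)

Definition ntrace N (x : 'M[C]_N) : C := \tr x / N%:R.

Lemma mxtrace_adjmx_mul N (x : 'M[C]_N) :
  \tr (adjmx x *m x) = \sum_i \sum_j `|x j i| ^+ 2.
Proof.
apply: eq_bigr => i _; rewrite mxE; apply: eq_bigr => j _.
by rewrite !mxE mulrC -normCK.
Qed.

Lemma ntrace_faithful_tracial_state N :
  (0 < N)%N -> faithful_tracial_state (fun _ => True) (@ntrace N).
Proof.
move=> N0; have N1 : N%:R != 0 :> C by rewrite pnatr_eq0 -lt0n.
rewrite /ntrace; split; [|split; [|split; [|split; [|split]]]].
- by move=> x y _ _; rewrite mxtraceD mulrDl.
- by move=> c x _; rewrite mxtraceZ mulrA.
- by rewrite mxtrace1 divff.
- move=> x _; rewrite mxtrace_adjmx_mul divr_ge0 ?ler0n //.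
  by do 2 apply: sumr_ge0 => ? _; rewrite exprn_ge0.
- move=> x _ /eqP; rewrite mxtrace_adjmx_mul mulf_eq0 invr_eq0 (negbTE N1) orbF.
  have sq_ge0 i j : 0 <= `|x j i| ^+ 2 by rewrite exprn_ge0.
  move=> /eqP/psumr_eq0P h; apply/matrixP => j i; rewrite mxE.
  have /psumr_eq0P h' := h (fun i _ => sumr_ge0 _ (fun j _ => sq_ge0 i j)) i isT.
  have /eqP := h' (fun j _ => sq_ge0 i j) j isT.
  by rewrite expf_eq0 /= normr_eq0 => /eqP.
- by move=> x y _ _; rewrite mxtrace_mulC.
Qed.

(** Take the full matrix algebra with its normalised trace, for which the [A k] are orthonormal. The
    coordinates [coef] then define the [U i], and the edge hypothesis makes the midpoints
    unitary. *)
Lemma gram_mem_F_fin n lam N (A : 'I_4 -> 'M[C]_N) :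
    (0 < N)%N -> `|lam| = 1 ->
    (forall k, adjmx (A k) *m A k = 1%:M) ->
    (forall k l, k != l -> \tr (adjmx (A k) *m A l) = 0) ->
    (forall k, adjmx (A k) *m (edge_phase lam k *: A (ordS k)) =
               adjmx (edge_phase lam k *: A (ordS k)) *m A k) ->
  F_fin n (gram n lam).
Proof.
move=> N0 lam1 A1 Atr Aedge.
pose U (i : nat) := \sum_k coef lam i k *: A k.
have delta (k : 'I_4) : \sum_(l < 4) (k == l)%:R *: A l = A k.
  rewrite (bigD1 k) //= eqxx scale1r big1 ?addr0 // => l.
  by rewrite eq_sym => /negbTE->; rewrite scale0r.
have Uunit i : adjmx (U i) *m U i = 1%:M.
  have [i4|i4] := ltnP i 4.
    suff -> : U i = A (Ordinal i4) by [].
    by rewrite -[RHS]delta; apply: eq_bigr => l _; rewrite -(coef_vertex lam).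
  have [i8|i8] := ltnP i 8; last first.
    suff -> : U i = A 0 by [].
    rewrite -[RHS]delta; apply: eq_bigr => l _.
    by rewrite /coef ltnNge i4 ltnNge i8.
  have ik : (i - 4 < 4)%N by rewrite ltn_subLR.
  pose k := Ordinal ik.
  suff -> : U i = (sqrtC 2)^-1 *: (A k + 'i *: (edge_phase lam k *: A (ordS k))).
    apply/mid_unitaryP => //.
    rewrite adjmxZ -scalemxAl -scalemxAr A1 scalerA mulrC -normCK.
    by rewrite /edge_phase; case: ifP; rewrite ?lam1 ?normr1 expr1n scale1r.
  rewrite -!delta !scaler_sumr -big_split scaler_sumr; apply: eq_bigr => l _.
  have -> : i = (4 + k)%N by rewrite subnKC.
  by rewrite coef_edge !scalerA /= -scalerDl scalerA.
exists N, (fun _ => True), (@ntrace N), (fun i : 'I_n => U i).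
split=> //; first exact: ntrace_faithful_tracial_state.
  by move=> i; split=> //; apply: mulmx1C.
move=> i j; rewrite mxE /ntrace adjmx_sum mulmx_sumr linear_sum mulr_suml.
apply: eq_bigr => k _; rewrite mulmx_suml linear_sum mulr_suml (bigD1 k) //=.
rewrite adjmxZ -scalemxAl -scalemxAr scalerA mxtraceZ A1 mxtrace1 big1.
  by rewrite addr0 mulfK ?pnatr_eq0 -?lt0n // mulrC.
move=> l lk; rewrite adjmxZ -scalemxAl -scalemxAr !mxtraceZ Atr //.
by rewrite !mulr0 mul0r.
Qed.

Definition monomial N (s : 'I_N -> 'I_N) (f : 'I_N -> C) : 'M[C]_N :=
  \matrix_(x, y) (f y * (x == s y)%:R).

Lemma adjmx_monomialE N (s t : 'I_N -> 'I_N) (f g : 'I_N -> C) y z :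
  (adjmx (monomial s f) *m monomial t g) y z = (f y)^* * g z * (s y == t z)%:R.
Proof.
rewrite mxE (bigD1 (s y)) //= !mxE eqxx mulr1 mulrA big1 ?addr0 // => x.
by rewrite !mxE => /negbTE->; rewrite mulr0 conjC0 mul0r.
Qed.

Lemma conjC_norm1 (a b : C) : `|a| = 1 -> a * b = 1 -> a^* = b.
Proof.
move=> a1 ab; have a0 : a != 0 by rewrite -normr_eq0 a1 oner_eq0.
by apply: (mulfI a0); rewrite ab -normCK a1 expr1n.
Qed.

(** Parity survives reduction modulo the even number [m.+2]. *)
Lemma odd_ordD m (x y : 'I_m.+2) :
  ~~ odd m -> odd (x + y)%R = odd x (+) odd y.
Proof. by move=> /negbTE m2; rewrite odd_mod ?oddD //= negbK. Qed.

Lemma odd_ord_nat m k : ~~ odd m -> odd (k%:R : 'I_m.+2) = odd k.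
Proof. by move=> /negbTE m2; rewrite Zp_nat /= odd_mod //= negbK. Qed.

(* On functions on Z/N, N = 4q, let A_k map e_y to f_k(y) e_(s_k(y)).  No two of
   the s_k agree at any point because 4 divides N, so the A_k are orthogonal;
   c^2 = lam^-3 makes both edges at A_3 selfadjoint. *)
Lemma gram_root_of_unity_F_fin n lam q :
  (0 < q)%N -> lam ^+ q = 1 -> F_fin n (gram n lam).
Proof.
move=> q0 lamq.
have lam1 : `|lam| = 1.
  by apply/eqP; rewrite -(@pexpr_eq1 _ _ q) // -normrX lamq normr1.
(* Writing 4q as [m.+2] gives the index type ['I_m.+2] the ring structure of Z/4q. *)
have [m Em] : exists m, m.+2 = (4 * q)%N.
  by exists (4 * q - 2)%N; rewrite -addn2 subnK // (leq_trans _ (leq_pmulr 4 q0)).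
have lamM : lam ^+ m.+2 = 1 by rewrite Em mulnC exprM lamq expr1n.
pose c := sqrtC (lam ^- 3).
have c2 : c ^+ 2 * lam ^+ 3 = 1.
  by rewrite sqrtCK mulVf // expf_neq0 // -normr_eq0 lam1 oner_eq0.
have c1 : `|c| = 1.
  apply/eqP; rewrite -(@pexpr_eq1 _ _ 2) //.
  by have /eqP := congr1 Num.norm c2; rewrite normrM !normrX lam1 expr1n mulr1 normr1.
(* Translations and reflections alternate, so s_k(y) = s_(k+1)(z) always fixes y + z, a condition
   symmetric in y and z. *)
pose s (k : 'I_4) (y : 'I_m.+2) : 'I_m.+2 :=
  nth 0 [:: y; 1 - y; y + 2; 3 - y] k.
pose f (k : 'I_4) (y : 'I_m.+2) : C := if k == 3 :> nat then c * lam ^+ y else 1.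
have m2 : ~~ odd m by have := congr1 odd Em; rewrite oddM /= negbK => ->.
have n20 : 2 != 0 :> 'I_m.+2.
  by rewrite Zp_nat -val_eqE /= modn_small // Em (leq_trans _ (leq_pmulr 4 q0)).
have lamD (x y : 'I_m.+2) : lam ^+ (x + y)%R = lam ^+ x * lam ^+ y.
  by rewrite /= expr_mod // exprD.
have lam_nat k : lam ^+ (k%:R : 'I_m.+2) = lam ^+ k.
  by rewrite Zp_nat /= expr_mod.
have f1 k y : `|f k y| = 1.
  by rewrite /f; case: ifP; rewrite ?normr1 // normrM normrX c1 lam1 expr1n mul1r.
have s_inj k : injective (s k).
  case: k => [[|[|[|[|//]]]] k4] x y; rewrite /s //=.
  - by move=> /addrI/oppr_inj.
  - by move=> /addIr.
  - by move=> /addrI/oppr_inj.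
have s_neq k l y : k != l -> s k y != s l y.
  wlog : k l / (k <= l)%N.
    move=> h; case/orP: (leq_total k l) => ? ?; first exact: h.
    by rewrite eq_sym h // eq_sym.
  have oddN (x : 'I_m.+2) : odd (- x)%R = odd x.
    by have := odd_ordD x (- x)%R m2; rewrite subrr /=; case: odd; case: odd.
  have odd_s (i : 'I_4) : odd (s i y) = odd i (+) odd y.
    have o1 : odd (1%R : 'I_m.+2) = true := odd_ord_nat 1 m2.
    have o2 : odd (2%R : 'I_m.+2) = false := odd_ord_nat 2 m2.
    have o3 : odd (3%R : 'I_m.+2) = true := odd_ord_nat 3 m2.
    case: i => [[|[|[|[|//]]]] i4] //.
    - by rewrite [LHS](odd_ordD 1%R (- y)%R m2) o1 oddN.
    - by rewrite [LHS](odd_ordD y 2%R m2) o2 addbF.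
    - by rewrite [LHS](odd_ordD 3%R (- y)%R m2) o3 oddN.
  (* Indices of opposite parity give values of opposite parity; for the pairs {0, 2} and {1, 3} the
     values differ by 2, which is nonzero. *)
  have [okl _ _|okl] := boolP (odd k != odd l).
    apply: contra_neq okl => skl.
    by rewrite -(addbK (odd y) (odd k)) -odd_s skl odd_s addbK.
  move: okl; case: k => [[|[|[|[|//]]]] k4]; case: l => [[|[|[|[|//]]]] l4] //= _ _ _.
  - by rewrite -subr_eq0 opprD addNKr oppr_eq0.
  - rewrite /s /= (inj_eq (addIr _)) -subr_eq0 -opprB oppr_eq0.
    have -> : 3 - 1 = 2 :> 'I_m.+2 by rewrite -[3]/(1 + 2) addrAC subrr add0r.
    exact: n20.
have reflE (u y z : 'I_m.+2) : (y == u - z) = (y + z == u).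
  by rewrite eq_sym subr_eq eq_sym.
apply: (@gram_mem_F_fin n lam m.+2 (fun k => monomial (s k) (f k))) => // [k|k l kl|k].
- apply/matrixP => y z; rewrite adjmx_monomialE mxE (inj_eq (@s_inj k)).
  have [->|_] := eqVneq y z; last by rewrite mulr0.
  by rewrite mulrC mul1r mulrC -normCK f1 expr1n.
- by apply: big1 => y _; rewrite adjmx_monomialE (negbTE (s_neq _ _ _ kl)) mulr0.
- apply/matrixP => y z; rewrite adjmxZ -scalemxAl -scalemxAr [LHS]mxE [RHS]mxE.
  rewrite !adjmx_monomialE.
  (* On the support y + z = j the product of the two phases of A_3 is constant. Edge 2 has j = 1 and
     two extra factors [lam], edge 3 has j = 3, so both reduce to c^2 lam^3 = 1. *)
  have f3 (v w : 'I_m.+2) (j : nat) : v + w = j%:R ->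
      (c * lam ^+ v) * (c * lam ^+ w) = c ^+ 2 * lam ^+ j.
    by move=> vw; rewrite mulrACA -expr2 -lamD vw lam_nat.
  case: k => [[|[|[|[|//]]]] k4]; rewrite /s /f /edge_phase /= ?conjC1 ?mul1r.
  + by rewrite [1 - y == z]eq_sym !reflE addrC.
  + rewrite [_ - y == _]eq_sym !reflE.
    by rewrite [z + 2 + y]addrAC [z + y]addrC [y + 2 + z]addrAC.
  + rewrite [_ - y == _]eq_sym !reflE.
    rewrite [z + 2 + y]addrAC [z + y]addrC [y + 2 + z]addrAC.
    rewrite -[3]/(1 + 2) (inj_eq (addIr _)).
    have [yz|_] := eqVneq; last by rewrite !mulr0.
    rewrite !mulr1 -rmorphM; apply/esym/conjC_norm1.
      by rewrite !normrM normrX lam1 c1 expr1n !mulr1.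
    by rewrite mulrACA (f3 _ _ 1) // mulrCA -expr2 -exprD.
  + rewrite [3 - y == z]eq_sym !reflE [z + y]addrC.
    have [yz|_] := eqVneq; last by rewrite !mulr0.
    rewrite !mulr1; apply: conjC_norm1; last by rewrite (f3 _ _ 3).
    by rewrite normrM normrX lam1 c1 expr1n mulr1.
Qed.

(** * Lipschitz dependence on the phase *)

Lemma coef_norm_le2 (lam : C) i k : `|lam| = 1 -> `|coef lam i k| <= 2.
Proof.
move=> lam1; have bool1 (b : bool) : `|b%:R : C| <= 1.
  by case: b; rewrite ?normr0 ?normr1.
have le12 : 1 <= 2 :> C by rewrite ler1n.
rewrite /coef; case: ifP => _; first exact: le_trans le12.
case: ifP => _; last exact: le_trans le12.
rewrite normrM -[leRHS]mulr1 ler_pM //.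
  apply: le_trans (ler_normD _ _) _; rewrite -[leRHS]/(1 + 1) lerD //.
  rewrite !normrM normCi mul1r; have -> : `|edge_phase lam (i - 4)| = 1.
    by rewrite /edge_phase; case: ifP; rewrite ?normr1.
  by rewrite mul1r.
rewrite normfV invf_le1 ?normr_gt0 ?sqrtC2_neq0 //.
by rewrite -(@ler_pXn2r _ 2) ?nnegrE // -normrX sqrtCK expr1n normr_nat.
Qed.

Lemma coef_lipschitz (lam mu : C) i k :
  `|coef lam i k - coef mu i k| <= `|lam - mu|.
Proof.
rewrite /coef; case: ifP => _; first by rewrite subrr normr0.
case: ifP => _; last by rewrite subrr normr0.
rewrite -mulrBl opprD addrACA subrr add0r -mulrBl -mulrBr !normrM normCi mul1r.
rewrite normfV -mulrA -[leRHS]mulr1 ler_pM //.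
  by rewrite /edge_phase; case: ifP => _ //; rewrite subrr normr0.
rewrite -[leRHS]mulr1 ler_pM //; first by case: eqP; rewrite ?normr0 ?normr1.
rewrite invf_le1 ?normr_gt0 ?sqrtC2_neq0 //.
by rewrite -(@ler_pXn2r _ 2) ?nnegrE // -normrX sqrtCK expr1n normr_nat ler1n.
Qed.

(** Each of the four products of coordinates varies by at most (2 + 2) |lam - mu|, since the factors
    are bounded by 2 and 1-Lipschitz; hence 16. *)
Lemma gram_lipschitz n (lam mu : C) i j : `|lam| = 1 -> `|mu| = 1 ->
  `|gram n lam i j - gram n mu i j| <= 16 * `|lam - mu|.
Proof.
move=> lam1 mu1; rewrite !mxE -sumrB; apply: le_trans (ler_norm_sum _ _ _) _.
have -> : 16 * `|lam - mu| = \sum_(k < 4) 4 * `|lam - mu|.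
  by rewrite sumr_const card_ord -[RHS]mulr_natl mulrA -natrM.
apply: ler_sum => k _.
rewrite -[X in `|X|](subrKA (coef mu i k * (coef lam j k)^*)) -mulrBl -mulrBr.
rewrite -rmorphB; apply: le_trans (ler_normD _ _) _.
rewrite !normrM !norm_conjC mulrC.
have -> : 4 * `|lam - mu| = 2 * `|lam - mu| + 2 * `|lam - mu|.
  by rewrite -mulrDl -natrD.
by rewrite lerD // ler_pM // ?coef_norm_le2 ?coef_lipschitz.
Qed.

(** * Density of the roots of unity, and a point of the circle that is not one *)

Section RootsOfUnity.
Variable R : realType.
Implicit Types (t : R) (n : nat) (z : R[i]).

Definition cis t : R[i] := (cos t +i* sin t)%C.

Lemma cisD s t : cis (s + t) = cis s * cis t.
Proof. by rewrite /cis cosD sinD /=; congr (_ +i* _)%C; rewrite [RHS]addrC. Qed.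

Lemma cis_exp t n : cis t ^+ n = cis (t *+ n).
Proof.
by elim: n => [|n IH]; rewrite ?mulr0n ?mulrS ?cisD -?IH ?exprS // /cis cos0 sin0.
Qed.

Lemma cis_2pi_int (m : int) : cis (m%:~R * (pi *+ 2)) = 1.
Proof.
have cis2pi : cis (pi *+ 2) = 1 by rewrite /cis cos2pi sin2pi.
case: m => m; first by rewrite mulr_natl -cis_exp cis2pi expr1n.
rewrite NegzE mulrNz mulNr mulr_natl; set x := _ *+ _.
have : cis x * cis (- x) = 1 by rewrite -cisD subrr /cis cos0 sin0.
by rewrite {1}/x -cis_exp cis2pi expr1n mul1r.
Qed.

Lemma cis_rat_root_of_unity (q : rat) :
  exists2 n, (0 < n)%N & cis (ratr q * (pi *+ 2)) ^+ n = 1.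
Proof.
exists `|denq q|%N; first by rewrite absz_gt0 denq_neq0.
rewrite cis_exp -mulr_natl mulrA natr_absz (ger0_norm (denq_ge0 q)) mulrC.
rewrite -(cis_2pi_int (numq q)); congr (cis _); rewrite mulrC; congr (_ * _).
by rewrite /ratr mulrC divfK // intr_eq0 denq_neq0.
Qed.

(** Rational multiples of 2 pi are dense among the angles and give roots of unity; continuity of cos
    and sin does the rest. *)
Lemma root_of_unity_near t (e : R) : 0 < e ->
  exists z n, [/\ (0 < n)%N, z ^+ n = 1 & `|z - cis t| < e%:C%C].
Proof.
move=> e0; pose a := pi *+ 2 : R.
have a0 : a != 0 by rewrite mulrn_eq0 /= gt_eqF ?pi_gt0.
have e20 : 0 < e / 2 by rewrite divr_gt0.
have cvga : (fun s => s * a) @ (t / a) --> t.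
  by rewrite -[X in _ --> X](divfK a0 t); apply: cvgMl; exact: cvg_id.
have cc : (fun s => cos (s * a)) @ (t / a) --> cos t.
  by apply: cvg_comp cvga _; exact: continuous_cos.
have cs : (fun s => sin (s * a)) @ (t / a) --> sin t.
  by apply: cvg_comp cvga _; exact: continuous_sin.
have /cvgr_dist_lt/(_ _ e20) nc := cc; have /cvgr_dist_lt/(_ _ e20) ns := cs.
have : nbhs (t / a)
    [set s : R | `|cos t - cos (s * a)| < e / 2 /\
                 `|sin t - sin (s * a)| < e / 2].
  exact: filterI nc ns.
rewrite nbhsE => -[W [oW Wt] sub].
have [x [/sub /= [hc hs] [q _ qx]]] := dense_rat (ex_intro _ _ Wt) oW; subst x.
have [n n0 hn] := cis_rat_root_of_unity q.
exists (cis (ratr q * a)), n; split=> //.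
rewrite distrC normc_def /= ltcR -[e in ltRHS]gtr0_norm // -sqrtr_sqr.
rewrite ltr_sqrt; last by rewrite exprn_gt0.
(* The bound [e / 2] on each coordinate makes each square less than half of e^2. *)
have sq (x : R) : `|x| < e / 2 -> x ^+ 2 < e ^+ 2 / 2.
  rewrite -[x ^+ 2]real_normK ?num_real //; move: `|x| (normr_ge0 x) => y y0 ye; nra.
by have := ltrD (sq _ hc) (sq _ hs); rewrite -splitr.
Qed.

(* (3 + 4i)^2 is congruent to 3 + 4i modulo 5. *)
Lemma exp_3_4i n : exists a b : int,
  ((3 +i* 4)%C : R[i]) ^+ n.+1 = ((5 * a + 3)%:~R +i* (5 * b + 4)%:~R)%C.
Proof.
elim: n => [|n [a [b IH]]]; first by exists 0, 0; rewrite expr1.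
exists (3 * a - 4 * b - 2), (4 * a + 3 * b + 4).
rewrite exprS IH /=; congr (_ +i* _)%C; rewrite !rmorphD !rmorphM ?rmorphN /=; ring.
Qed.

(** By [exp_3_4i] the imaginary part of (3 + 4i)^n is 4 modulo 5, hence nonzero, so no positive
    power is real. *)
Lemma pythagorean_not_root_of_unity n :
  (0 < n)%N -> ((3 / 5) +i* (4 / 5))%C ^+ n != 1 :> R[i].
Proof.
case: n => // n _; apply/eqP.
have -> : ((3 / 5) +i* (4 / 5))%C = (3 +i* 4)%C * (5^-1)%:C%C :> R[i].
  by rewrite /=; apply/eqP; rewrite eq_complex /= !mulr0 subr0 add0r !eqxx.
have [a [b ab]] := exp_3_4i n.
rewrite exprMn ab -rmorphXn /= => /(congr1 (fun z : R[i] => complex.Im z)) /=.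
rewrite mulr0 add0r => /eqP; rewrite mulf_eq0 expf_eq0 invr_eq0 pnatr_eq0 /= orbF.
rewrite intr_eq0 => /eqP; lia.
Qed.

Lemma cis_acos_3_5 : cis (acos (3 / 5)) = ((3 / 5) +i* (4 / 5))%C.
Proof.
have h : -1 <= (3 / 5 : R) <= 1 by apply/andP; split; lra.
rewrite /cis sin_acos // acosK ?in_itv //=; congr (_ +i* _)%C.
have -> : 1 - (3 / 5) ^+ 2 = (4 / 5) ^+ 2 :> R by field.
by rewrite sqrtr_sqr ger0_norm // divr_ge0.
Qed.

End RootsOfUnity.

(** * The limit point outside the set *)

Theorem theorem2p3 (n : nat) : (8 <= n)%N -> ~ closed (F_fin n).
Proof.
move=> n8 clF.
pose mu : C := cis (acos (3 / 5)).
have mu_root N : (0 < N)%N -> mu ^+ N != 1.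
  by move=> N0; rewrite /mu cis_acos_3_5; exact: pythagorean_not_root_of_unity.
have mu1 : `|mu| = 1.
  by rewrite [LHS]normc_def /= cos2Dsin2 sqrtr1.
suff /clF/(gram_F_fin_root_of_unity n8 mu1) [N N0 /eqP] : closure (F_fin n) (gram n mu).
  by apply/negP; exact: mu_root.
move=> B /nbhs_ballP [e /= e0 eB].
(* Radii of balls lie in [C]; a positive one is real, which is what [root_of_unity_near] needs.
   Dividing by 16 then offsets the Lipschitz constant. *)
have e_real : e = (complex.Re e)%:C%C by apply/esym/RRe_real; exact: gtr0_real.
have [|z [q [q0 zq zmu]]] := @root_of_unity_near _ (acos (3 / 5)) (complex.Re e / 16).
  by rewrite divr_gt0 // -ltcR -e_real.
exists (gram n (z : C)); split; first exact: gram_root_of_unity_F_fin zq.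
apply: eB; split=> // i j.
have z1 : `|z : C| = 1.
  by apply/eqP; rewrite -(@pexpr_eq1 _ _ q) // -normrX [_ ^+ q]zq normr1.
rewrite /ball /= distrC; apply: le_lt_trans (gram_lipschitz _ _ z1 mu1) _.
have e16 : e = 16 * (complex.Re e / 16)%:C%C.
  rewrite {1}e_real -(rmorph_nat (@real_complex _)) -rmorphM /=.
  by rewrite mulrC divfK.
by rewrite [ltRHS]e16 ltr_pM2l // ltr0n.
Qed.
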